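(* For any Rademacher sum $X=\sum_{i=1}^na_i\varepsilon_i\in\mathcal{X}$, we have $\mathbb{P}(|X|\geq 2/\sqrt{6})\geq 1/4$.
   Context: $\mathcal{X}$ denotes the set of Rademacher sums $X=\sum_{i=1}^na_i\varepsilon_i$ where $a_1\geq a_2\geq\dots\geq a_n>0$ are real constants with $a_1^2+\dots+a_n^2=1$ (i.e. $\mathrm{Var}(X)=1$), and the $\varepsilon_i$ are independent random signs uniformly distributed on $\{-1,+1\}$. *)

(* Defs.v *)
From HB Require Import structures.
From mathcomp Require Import all_boot all_order all_algebra.
From mathcomp Require Import all_classical all_reals all_analysis.
Set Implicit Arguments.
Unset Strict Implicit.
Unset Printing Implicit Defensive.
Import Order.TTheory GRing.Theory Num.Theory.
Import numFieldNormedType.Exports.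
Local Open Scope classical_set_scope.
Local Open Scope ring_scope.

Definition mutually_independent (d : measure_display) (T : measurableType d)
    (R : realType) (P : probability T R) (I : finType)
    (Y : I -> {RV P >-> R}) : Prop :=
  forall (J : {set I}) (B : I -> set R),
    (forall i, measurable (B i)) ->
    P (\bigcap_(i in [set` J]) (Y i @^-1` B i)) =
      (\prod_(i in J) P (Y i @^-1` B i))%E.

Definition random_sign (d : measure_display) (T : measurableType d)
    (R : realType) (P : probability T R) (e : {RV P >-> R}) : Prop :=
  P (e @^-1` [set 1]) = (2^-1)%:E /\ P (e @^-1` [set -1]) = (2^-1)%:E.

(* The index i : 'I_n stands for i + 1 in the usual a_1 >= ... >= a_n > 0. *)
Definition rademacher_coefficients (R : realType) (n : nat)
    (a : 'I_n -> R) : Prop :=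
  [/\ forall i j : 'I_n, (i <= j)%N -> a j <= a i,
      forall i : 'I_n, 0 < a i
    & \sum_(i < n) a i ^+ 2 = 1].

Definition rademacher_sum (d : measure_display) (T : measurableType d)
    (R : realType) (P : probability T R) (n : nat)
    (a : 'I_n -> R) (eps : 'I_n -> {RV P >-> R}) : T -> R :=
  fun t => \sum_(i < n) a i * eps i t.

(* Main.v *)
(* Order the coefficients decreasingly and let c = 2 / sqrt 6, so c^2 = 2/3; we
   bound P(|X| < c) by 3/4. If a1 + a2 >= c, symmetry suffices. In general the
   indicator of (-c, c) is at most a trigonometric polynomial Q (cos (31 x / 20)),
   whose mean is a combination of the products of cos (k * 31/20 * a_i) for
   k = 1, 2, 3, 5; these are small because |cos x| <= exp (- q x^2) for suitable
   q on suitable intervals. This only fails when a4 + a5 + a6 >= c and either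
   a3 + a6 + a7 + a8 >= c, where a Littlewood-Offord pairing of the 256 sign
   patterns of a1, ..., a8 gives 191/256, or a1, ..., a6 carry almost all of the
   variance. They are then all close to c/2 = 1 / sqrt 6, the configuration in
   which 2 / sqrt 6 is an atom of |X|; conditionally on their signs, the remaining
   sum is controlled by its second moment (Chebyshev) when the six signs lead far
   beyond c, and by its fourth moment (Paley-Zygmund) when they lead close to c. *)
Require Import Defs.
From HB Require Import structures.
From mathcomp Require Import all_boot all_order all_algebra.
From mathcomp Require Import all_classical all_reals all_analysis.
From mathcomp Require Import measurable_realfun ring lra.
Set Implicit Arguments.
Unset Strict Implicit.
Unset Printing Implicit Defensive.
Import Order.TTheory GRing.Theory Num.Theory.
Import numFieldNormedType.Exports.
Local Open Scope classical_set_scope.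
Local Open Scope ring_scope.

(** * Averages over sign patterns, as a finite recursion *)

Section SignMean.
Context {R : realType}.
Implicit Types (l : seq R) (f g : R -> R) (x y k : R).

(** The expectation of [f (x + X)] for the Rademacher sum [X] with coefficients [l]. No probability
    space is involved, so every fact is an induction on [l] with [x] free. *)
Fixpoint sign_mean l f x : R :=
  if l is a :: l' then (sign_mean l' f (x + a) + sign_mean l' f (x - a)) / 2
  else f x.

Lemma le_sign_mean l f g x :
  (forall y, f y <= g y) -> sign_mean l f x <= sign_mean l g x.
Proof.
move=> fg; elim: l x => [|a l IH] x //=.
by rewrite ler_pM2r ?invr_gt0 ?ltr0n// lerD.
Qed.

Lemma eq_sign_mean l f g x : f =1 g -> sign_mean l f x = sign_mean l g x.
Proof. by move=> fg; elim: l x => [|a l IH] x /=; rewrite ?fg// !IH. Qed.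

Lemma sign_mean_cst l k x : sign_mean l (fun=> k) x = k.
Proof. by elim: l x => [|a l IH] x //=; rewrite !IH; field. Qed.

Lemma sign_meanD l f g x :
  sign_mean l (fun y => f y + g y) x = sign_mean l f x + sign_mean l g x.
Proof. by elim: l x => [|a l IH] x //=; rewrite !IH; field. Qed.

Lemma sign_meanZ l f k x :
  sign_mean l (fun y => k * f y) x = k * sign_mean l f x.
Proof. by elim: l x => [|a l IH] x //=; rewrite !IH; field. Qed.

Lemma sign_mean_even l f x :
  (forall y, f (- y) = f y) -> sign_mean l f (- x) = sign_mean l f x.
Proof.
move=> fN; elim: l x => [|a l IH] x //=.
have -> : - x + a = - (x - a) by rewrite opprB addrC.
have -> : - x - a = - (x + a) by rewrite opprD.
by rewrite !IH addrC.
Qed.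

Lemma sign_mean_shift l f x :
  sign_mean l f x = sign_mean l (fun y => f (x + y)) 0.
Proof.
suff H y z : sign_mean l f (y + z) = sign_mean l (fun t => f (y + t)) z.
  by rewrite -H addr0.
elim: l y z => [|a l IH] y z //=.
by rewrite -!IH !addrA.
Qed.

Lemma sign_mean_opp l f : sign_mean l f 0 = sign_mean l (fun y => f (- y)) 0.
Proof.
suff H z : sign_mean l f z = sign_mean l (fun t => f (- t)) (- z).
  by rewrite H oppr0.
elim: l z => [|a l IH] z /=; first by rewrite opprK.
have -> : - z + a = - (z - a) by rewrite opprB addrC.
have -> : - z - a = - (z + a) by rewrite opprD.
by rewrite -!IH addrC.
Qed.

(** In the addition formulas the sine terms of the two shifts cancel: this is the factorised
    characteristic function. *)
Lemma sign_mean_cos l k x :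
  sign_mean l (fun y => cos (k * y)) x =
  cos (k * x) * \prod_(a <- l) cos (k * a).
Proof.
elim: l x => [|a l IH] x /=; first by rewrite big_nil mulr1.
by rewrite big_cons !IH [k * (x + a)]mulrDr [k * (x - a)]mulrBr cosD cosB; field.
Qed.

Lemma sign_mean_sq l x :
  sign_mean l (fun y => y ^+ 2) x = x ^+ 2 + \sum_(a <- l) a ^+ 2.
Proof.
elim: l x => [|a l IH] x /=; first by rewrite big_nil addr0.
by rewrite big_cons !IH; field.
Qed.

(** The right-hand side is the fourth moment of a Gaussian of mean [x] and the same variance; each
    coefficient [a] leaves a slack of [2 * a ^+ 4]. *)
Lemma sign_mean_pow4_le l x :
  sign_mean l (fun y => y ^+ 4) x <=
  x ^+ 4 + 6 * x ^+ 2 * (\sum_(a <- l) a ^+ 2)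
    + 3 * (\sum_(a <- l) a ^+ 2) ^+ 2.
Proof.
elim: l x => [|a l IH] x /=.
  by rewrite big_nil expr0n/= !mulr0 !addr0.
rewrite big_cons; set w := \sum_(_ <- _) _ in IH *.
have := IH (x + a); have := IH (x - a); have := sqr_ge0 (a ^+ 2).
move: (sign_mean _ _ _) (sign_mean _ _ _) => u v.
have -> : (a ^+ 2) ^+ 2 = a ^+ 4 by ring.
rewrite !exprS !expr0; lra.
Qed.

Lemma sign_mean_zeros l f x n :
  sign_mean (l ++ nseq n 0) f x = sign_mean l f x.
Proof.
elim: l x => [|a l IH] x /=; last by rewrite !IH.
by elim: n => //= n IH; rewrite addr0 subr0 IH; field.
Qed.

End SignMean.

(** * Taylor bounds, and Gaussian bounds for products of cosines *)

Section AnalyticBounds.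
Context {R : realType}.
Implicit Types (f : R -> R) (x t k b : R).

(** Integrates an inequality from 0: each Taylor bound below follows from the previous one for its
    derivative. *)
Lemma derive_ge0_ge0 f (f' : R -> R) :
  (forall x, is_derive x 1 f (f' x)) -> (forall x, 0 <= x -> 0 <= f' x) ->
  f 0 = 0 -> forall x, 0 <= x -> 0 <= f x.
Proof.
move=> fd f'0 f0 x; rewrite le_eqVlt => /predU1P[<-|x0]; first by rewrite f0.
have cf : {within `[0, x], continuous f}.
  apply: derivable_within_continuous => y _.
  by have [] := fd y.
have [z /[!in_itv]/= /andP[z0 _]] := MVT x0 (fun y _ => fd y) cf.
rewrite f0 !subr0 => ->.
by apply: mulr_ge0; rewrite ?f'0// ltW.
Qed.

Lemma sin_ge x : 0 <= x -> x - x ^+ 3 / 6 <= sin x.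
Proof.
move=> x0; rewrite -subr_ge0.
apply: (@derive_ge0_ge0 (fun x => sin x - (x - x ^+ 3 / 6))
  (fun x => cos x - (1 - x ^+ 2 / 2))) x0.
- move=> y; apply: is_derive_eq.
  by rewrite /GRing.scale/=; field.
- apply: (@derive_ge0_ge0 (fun x => cos x - (1 - x ^+ 2 / 2)) (fun x => x - sin x)).
  + move=> y; apply: is_derive_eq.
    by rewrite /GRing.scale/=; field.
  + apply: (@derive_ge0_ge0 (fun x => x - sin x) (fun x => 1 - cos x)).
    * by move=> y _; rewrite subr_ge0 cos_le1.
    * by rewrite sin0 subr0.
  + by rewrite cos0 expr0n/= mul0r subr0 subrr.
- by rewrite sin0 expr0n/= mul0r !subr0.
Qed.

Lemma cos_le x : 0 <= x -> cos x <= 1 - x ^+ 2 / 2 + x ^+ 4 / 24.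
Proof.
move=> x0; rewrite -subr_ge0.
apply: (@derive_ge0_ge0 (fun x => 1 - x ^+ 2 / 2 + x ^+ 4 / 24 - cos x)
  (fun x => sin x - (x - x ^+ 3 / 6))) x0.
- move=> y; apply: is_derive_eq.
  by rewrite /GRing.scale/=; field.
- by move=> y y0; rewrite subr_ge0 sin_ge.
- by rewrite cos0 !expr0n/= !mul0r subr0 addr0 subrr.
Qed.

Lemma sin_le x : 0 <= x -> sin x <= x - x ^+ 3 / 6 + x ^+ 5 / 120.
Proof.
move=> x0; rewrite -subr_ge0.
apply: (@derive_ge0_ge0 (fun x => x - x ^+ 3 / 6 + x ^+ 5 / 120 - sin x)
  (fun x => 1 - x ^+ 2 / 2 + x ^+ 4 / 24 - cos x)) x0.
- move=> y; apply: is_derive_eq.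
  by rewrite /GRing.scale/=; field.
- by move=> y y0; rewrite subr_ge0 cos_le.
- by rewrite sin0 !expr0n/= !mul0r !subr0 addr0.
Qed.

Lemma cos_ge x : 0 <= x ->
  1 - x ^+ 2 / 2 + x ^+ 4 / 24 - x ^+ 6 / 720 <= cos x.
Proof.
move=> x0; rewrite -subr_ge0.
have : 6 * 720^-1 = 120^-1 :> R by field.
move: (720^-1) => k k6.
apply: (@derive_ge0_ge0 (fun x => cos x - (1 - x ^+ 2 / 2 + x ^+ 4 / 24 - x ^+ 6 * k))
  (fun x => x - x ^+ 3 / 6 + x ^+ 5 * (6 * k) - sin x)) x0.
- move=> y; apply: is_derive_eq.
  by rewrite /GRing.scale/=; field.
- by move=> y y0; rewrite k6 subr_ge0 sin_le.
- by rewrite cos0 !expr0n/= !mul0r !subr0 addr0 subrr.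
Qed.

Lemma expRN_le t : 0 <= t -> expR (- t) <= 1 - t + t ^+ 2 / 2.
Proof.
move=> t0; rewrite -subr_ge0.
apply: (@derive_ge0_ge0 (fun t => 1 - t + t ^+ 2 / 2 - expR (- t))
  (fun t => expR (- t) - (1 - t))) t0.
- move=> y; apply: is_derive_eq.
  by rewrite /GRing.scale/=; field.
- by move=> y _; rewrite subr_ge0 expR_ge1Dx.
- by rewrite oppr0 expR0 expr0n/= mul0r !addr0 subrr.
Qed.

Lemma expRN_ge t : 0 <= t -> 1 - t + t ^+ 2 / 2 - t ^+ 3 / 6 <= expR (- t).
Proof.
move=> t0; rewrite -subr_ge0.
apply: (@derive_ge0_ge0 (fun t => expR (- t) - (1 - t + t ^+ 2 / 2 - t ^+ 3 / 6))
  (fun t => 1 - t + t ^+ 2 / 2 - expR (- t))) t0.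
- move=> y; apply: is_derive_eq.
  by rewrite /GRing.scale/=; field.
- by move=> y y0; rewrite subr_ge0 expRN_le.
- by rewrite oppr0 expR0 !expr0n/= !mul0r !(addr0, subr0) subrr.
Qed.

(** Cutting the exponent into sixteen parts makes the quadratic Taylor bound sharp enough for the
    rational estimates that follow. *)
Lemma expRN16_le t : 0 <= t -> t <= 1 ->
  expR (- (16 * t)) <= (1 - t + t ^+ 2 / 2) ^+ 16.
Proof.
move=> t0 t1; rewrite -mulrN expRM_natl.
rewrite lerXn2r ?nnegrE ?expR_ge0 ?expRN_le//.
have := sqr_ge0 t; lra.
Qed.

(** With u = x^2 / 2, the lower Taylor polynomial of the exponential exceeds the upper one of the
    cosine by u^2 (2 - u) / 6, and u <= 2. *)
Lemma cos_le_expR x : 0 <= x -> x <= 2 -> cos x <= expR (- (x ^+ 2 / 2)).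
Proof.
move=> x0 x2; apply: le_trans (cos_le x0) _.
have u0 : 0 <= x ^+ 2 / 2 by rewrite divr_ge0// sqr_ge0.
apply: le_trans (expRN_ge u0).
have h : x ^+ 2 <= 4 by nra.
have -> : x ^+ 4 = (x ^+ 2) ^+ 2 by ring.
move: (x ^+ 2) h u0 => y y4 y0; nra.
Qed.

Lemma cos_le_expR_weak k x : 0 <= x -> x <= 3 ->
  (1 - 2 * k) * 12 >= x ^+ 2 -> cos x <= expR (- (k * x ^+ 2)).
Proof.
move=> x0 x3 hk; apply: le_trans (cos_le x0) _.
apply: le_trans (expR_ge1Dx _).
have -> : x ^+ 4 = (x ^+ 2) ^+ 2 by ring.
have := sqr_ge0 x; move: (x ^+ 2) hk => y hk y0; nra.
Qed.

(* The right-hand side of [cos_ge] decreases up to [x ^+ 2 = 10 - sqrt 20]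
   and the exponential decreases too, so it suffices to compare at [b]. *)
Lemma norm_cos_le_expR k b x : 0 <= k -> 0 <= x -> x <= b -> b ^+ 2 <= 9 / 2 ->
  cos x <= expR (- (k * x ^+ 2)) ->
  b ^+ 2 / 2 - 1 - b ^+ 4 / 24 + b ^+ 6 / 720 <= expR (- (k * b ^+ 2)) ->
  `|cos x| <= expR (- (k * x ^+ 2)).
Proof.
move=> k0 x0 xb b2 hcos hb; rewrite ler_norml hcos andbT.
rewrite lerNl.
have xb2 : x ^+ 2 <= b ^+ 2 by nra.
apply: (@le_trans _ _ (expR (- (k * b ^+ 2)))); last first.
  by rewrite ler_expR lerN2 ler_wpM2l.
apply: le_trans hb; have := cos_ge x0; rewrite lerNl => /(le_trans _); apply.
have -> : x ^+ 4 = (x ^+ 2) ^+ 2 by ring.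
have -> : x ^+ 6 = (x ^+ 2) ^+ 3 by ring.
have -> : b ^+ 4 = (b ^+ 2) ^+ 2 by ring.
have -> : b ^+ 6 = (b ^+ 2) ^+ 3 by ring.
have := sqr_ge0 x; move: (x ^+ 2) (b ^+ 2) xb2 b2 => y z yz z1 y0.
have h : 0 <= (z - y) * (1 / 2 - (z + y) / 24 + (z ^+ 2 + z * y + y ^+ 2) / 720).
  by apply: mulr_ge0; nra.
move: h; rewrite -subr_ge0 => h; rewrite -subr_ge0.
apply: le_trans h _; rewrite le_eqVlt; apply/orP; left; apply/eqP; by field.
Qed.

Lemma expRN4_ge t : 0 <= t -> t <= 1 ->
  (1 - t + t ^+ 2 / 2 - t ^+ 3 / 6) ^+ 4 <= expR (- (4 * t)).
Proof.
move=> t0 t1; rewrite -(mulrN 4 t) expRM_natl.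
rewrite lerXn2r ?nnegrE ?expR_ge0 ?expRN_ge//.
have := sqr_ge0 t; nra.
Qed.

(** Beyond pi / 2 the modulus of the cosine grows again, so a longer interval costs a smaller rate.
    The ends 7/4, 19/10 and 211/100 of the three bounds just cover 31/4 * 1129/5000, 93/20 *
    1633/4000 and 31/4 * 1633/6000, the largest angles to which each is applied. *)
Lemma norm_cos_le_expR_half x : 0 <= x -> x <= 7 / 4 ->
  `|cos x| <= expR (- (1 / 2 * x ^+ 2)).
Proof.
move=> x0 xb; apply: (norm_cos_le_expR _ x0 xb); [lra|lra| |].
  rewrite [1 / 2 * _]mulrC mulrA mulr1.
  by apply: cos_le_expR => //; lra.
have -> : 1 / 2 * (7 / 4) ^+ 2 = 4 * (49 / 128) :> R by field.
apply: le_trans (expRN4_ge _ _); lra.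
Qed.

Lemma norm_cos_le_expR_k3 x : 0 <= x -> x <= 19 / 10 ->
  `|cos x| <= expR (- (3 / 10 * x ^+ 2)).
Proof.
move=> x0 xb; apply: (norm_cos_le_expR _ x0 xb); [lra|lra| |].
  by apply: cos_le_expR_weak => //; nra.
have -> : 3 / 10 * (19 / 10) ^+ 2 = 4 * (1083 / 4000) :> R by field.
apply: le_trans (expRN4_ge _ _); lra.
Qed.

Lemma norm_cos_le_expR_k14 x : 0 <= x -> x <= 211 / 100 ->
  `|cos x| <= expR (- (7 / 50 * x ^+ 2)).
Proof.
move=> x0 xb; apply: (norm_cos_le_expR _ x0 xb); [lra|lra| |].
  by apply: cos_le_expR_weak => //; nra.
have -> : 7 / 50 * (211 / 100) ^+ 2 = 4 * (7 / 200 * (211 / 100) ^+ 2) :> R by field.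
apply: le_trans (expRN4_ge _ _); lra.
Qed.

Lemma norm_prod_cos_le1 t (l : seq R) : `|\prod_(a <- l) cos (t * a)| <= 1.
Proof.
elim: l => [|a l IH]; first by rewrite big_nil normr1.
by rewrite big_cons normrM mulr_ile1// ler_norml cos_geN1 cos_le1.
Qed.

Lemma norm_prod_cos_le k b t (l : seq R) : 0 <= t ->
  (forall x, 0 <= x -> x <= b -> `|cos x| <= expR (- (k * x ^+ 2))) ->
  (forall a, a \in l -> 0 <= a /\ t * a <= b) ->
  `|\prod_(a <- l) cos (t * a)| <= expR (- (k * t ^+ 2 * \sum_(a <- l) a ^+ 2)).
Proof.
move=> t0 hcos; elim: l => [|a l IH] hl.
  by rewrite !big_nil normr1 mulr0 oppr0 expR0.
have [a0 ab] := hl a (mem_head _ _).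
rewrite !big_cons normrM mulrDr opprD expRD ler_pM//; last first.
  by apply: IH => c cl; apply: hl; rewrite inE cl orbT.
have -> : k * t ^+ 2 * a ^+ 2 = k * (t * a) ^+ 2 by ring.
by apply: hcos => //; apply: mulr_ge0.
Qed.

End AnalyticBounds.

(** * The trigonometric majorant of the indicator of (-c, c) *)

Section TestFunction.
Context {R : realType}.
Implicit Types (c t x y : R) (l : seq R).

(* Chosen numerically: nonnegative on [-1, 1], at least 1 on [cos (31 c / 20), 1],
   and such that [quintic (cos u)] has no [cos (4 u)] term and a small mean. *)
Definition quintic y : R :=
  576 / 1000 + 1643 / 1000 * y - 54 / 1000 * y ^+ 2 - 2488 / 1000 * y ^+ 3
  + 1360 / 1000 * y ^+ 5.

(* Euclidean division by the square of an approximate double root at -0.57. *)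
Lemma quintic_ge0 y : -1 <= y -> y <= 1 -> 0 <= quintic y.
Proof.
move=> y1 y2; rewrite /quintic.
pose r : R := 569 / 1000; pose k2 : R := - 2 * r * (136 / 100).
pose k1 : R := - (2488 / 1000) - r ^+ 2 * (136 / 100) - 2 * r * k2.
pose k0 : R := - (54 / 1000) - r ^+ 2 * k2 - 2 * r * k1.
pose K := 136 / 100 * y ^+ 3 + k2 * y ^+ 2 + k1 * y + k0.
have K0 : 0 <= K.
  have y0 : 0 <= y + 1 by lra.
  have q0 : 0 <= 136 / 100 * (y + 1) ^+ 2 - 563 / 100 * (y + 1) + 6.
    have := sqr_ge0 (y + 1 - 207 / 100); lra.
  rewrite /K /k0 /k1 /k2 /r; have := mulr_ge0 y0 q0.
  have := mulr_ge0 y0 y0; lra.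
have := mulr_ge0 (sqr_ge0 (y + r)) K0; rewrite /K /k0 /k1 /k2 /r.
lra.
Qed.

(* The same division at the near-double root 0.906 and the simple root 0.3. *)
Lemma quintic_ge1 y : 3 / 10 <= y -> y <= 1 -> 1 <= quintic y.
Proof.
move=> y1 y2; rewrite /quintic.
pose r : R := 906 / 1000; pose s := 2 * r + 3 / 10.
pose k1 : R := s * (136 / 100).
pose k0 : R := - (2488 / 1000) + s * k1 - (r ^+ 2 + 6 / 10 * r) * (136 / 100).
pose K := 136 / 100 * y ^+ 2 + k1 * y + k0.
have K0 : 0 <= K by rewrite /K /k0 /k1 /s /r; nra.
have y30 : 0 <= y - 3 / 10 by lra.
have := mulr_ge0 (mulr_ge0 y30 (sqr_ge0 (y - r))) K0; rewrite /K /k0 /k1 /s /r.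
have := sqr_ge0 (y - 7 / 10); lra.
Qed.

(** The Chebyshev expansion of [quintic] at cos (31 x / 20): the frequencies are 1, 2, 3 and 5 times
    31/20. *)
Definition test_fun x : R :=
  549 / 1000 + 627 / 1000 * cos (31 / 20 * x) + - (27 / 1000) * cos (31 / 10 * x)
  + - (197 / 1000) * cos (93 / 20 * x) + 85 / 1000 * cos (31 / 4 * x).

Lemma test_funE x : test_fun x = quintic (cos (31 / 20 * x)).
Proof.
rewrite /test_fun /quintic.
have -> : 31 / 10 * x = (31 / 20 * x) + (31 / 20 * x) by field.
have -> : 93 / 20 * x = (31 / 20 * x) + (31 / 20 * x) + (31 / 20 * x) by field.
have -> : 31 / 4 * x = (31 / 20 * x) + (31 / 20 * x) + (31 / 20 * x)
   + ((31 / 20 * x) + (31 / 20 * x)) by field.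
set u := 31 / 20 * x.
rewrite !(cosD, sinD).
have h := cos2Dsin2 u.
have {}h : sin u ^+ 2 = 1 - cos u ^+ 2 by rewrite -h; ring.
set C := cos u in h *; set S := sin u in h *.
have e1 : S * S = 1 - C ^+ 2 by rewrite -h.
have -> : C * C - S * S = 2 * C ^+ 2 - 1 by rewrite e1; ring.
have -> : (2 * C ^+ 2 - 1) * C - (S * C + C * S) * S = 4 * C ^+ 3 - 3 * C.
  have -> : (S * C + C * S) * S = 2 * C * (S * S) by ring.
  by rewrite e1; ring.
have -> : ((S * C + C * S) * C + (2 * C ^+ 2 - 1) * S) * (S * C + C * S)
  = (4 * C ^+ 2 - 1) * 2 * C * (S * S) by ring.
by rewrite e1; field.
Qed.

Lemma indicator_le_test_fun c x : 0 < c -> c ^+ 2 = 2 / 3 ->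
  (`|x| < c)%R%:R <= test_fun x.
Proof.
move=> c0 c2; rewrite test_funE; have [xc|_] := ltP `|x| c; last first.
  by rewrite quintic_ge0 ?cos_geN1 ?cos_le1.
apply: quintic_ge1; last exact: cos_le1.
have -> : cos (31 / 20 * x) = cos (31 / 20 * `|x|).
  by have [x0|x0] := leP 0 x; [rewrite ger0_norm|rewrite ltr0_norm// mulrN cosN].
have x0 : 0 <= `|x| by [].
have x2 : `|x| ^+ 2 <= 2 / 3 by rewrite -c2; nra.
(* At x^2 = 2/3 this Taylor bound is about 0.3003, just above the threshold 3/10 of
   [quintic_ge1]. *)
apply: le_trans (cos_ge _); last by apply: mulr_ge0 => //; lra.
rewrite !exprMn.
have -> : `|x| ^+ 4 = (`|x| ^+ 2) ^+ 2 by ring.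
have -> : `|x| ^+ 6 = (`|x| ^+ 2) ^+ 3 by ring.
have := sqr_ge0 `|x|; move: (`|x| ^+ 2) x2 => z z1 z0.
have : 0 <= (2 / 3 - z) * ((2 / 3) ^+ 2 + 2 / 3 * z + z ^+ 2).
  by apply: mulr_ge0; nra.
have : 0 <= (2 / 3 - z) * z by apply: mulr_ge0; lra.
rewrite !exprS !expr0; nra.
Qed.

Lemma sign_mean_lt_le c l : 0 < c -> c ^+ 2 = 2 / 3 ->
  sign_mean l (fun y => (`|y| < c)%R%:R) 0 <=
  549 / 1000 + 627 / 1000 * \prod_(a <- l) cos (31 / 20 * a)
  + - (27 / 1000) * \prod_(a <- l) cos (31 / 10 * a)
  + - (197 / 1000) * \prod_(a <- l) cos (93 / 20 * a)
  + 85 / 1000 * \prod_(a <- l) cos (31 / 4 * a).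
Proof.
move=> c0 c2; have := le_sign_mean l 0 (fun y => indicator_le_test_fun y c0 c2).
move/le_trans; apply; rewrite /test_fun !sign_meanD !sign_meanZ !sign_mean_cos.
by rewrite sign_mean_cst !mulr0 cos0 !mul1r.
Qed.

End TestFunction.

(** * Hit probability bounds from the products of cosines *)

Section FourierBounds.
Context {R : realType}.
Implicit Types (c t k b q v : R) (p l : seq R).

Lemma expRN_le_pow16 (s u q : R) : 0 <= u -> u <= 1 -> 16 * u <= s ->
  (1 - u + u ^+ 2 / 2) ^+ 16 <= q -> expR (- s) <= q.
Proof.
move=> u0 u1 us; apply: le_trans; apply: le_trans (expRN16_le u0 u1).
by rewrite ler_expR lerN2.
Qed.

Lemma norm_prod_cos_cat_le t p l :
  `|\prod_(a <- p ++ l) cos (t * a)| <= `|\prod_(a <- l) cos (t * a)|.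
Proof. by rewrite big_cat normrM ler_piMl// norm_prod_cos_le1. Qed.

Lemma norm_prod_cos_tail_le k b t v u q p l : 0 <= k -> 0 <= t ->
  (forall x, 0 <= x -> x <= b -> `|cos x| <= expR (- (k * x ^+ 2))) ->
  (forall a, a \in l -> 0 <= a /\ t * a <= b) ->
  v <= \sum_(a <- l) a ^+ 2 ->
  0 <= u -> u <= 1 -> 16 * u <= k * t ^+ 2 * v ->
  (1 - u + u ^+ 2 / 2) ^+ 16 <= q ->
  `|\prod_(a <- p ++ l) cos (t * a)| <= q.
Proof.
move=> k0 t0 hc hl hv u0 u1 hu; apply: le_trans.
apply: le_trans (norm_prod_cos_cat_le _ _ _) _.
apply: le_trans (norm_prod_cos_le t0 hc hl) _.
apply: (expRN_le_pow16 u0 u1) => //; apply: le_trans hu _.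
by rewrite ler_wpM2l// mulr_ge0// sqr_ge0.
Qed.

Lemma ub_sqrt_two_thirds c : 0 < c -> c ^+ 2 = 2 / 3 -> c <= 1633 / 2000.
Proof.
move=> c0 c2; rewrite leNgt; apply/negP => h; nra.
Qed.

Lemma lb_sqrt_two_thirds c : 0 < c -> c ^+ 2 = 2 / 3 -> 816 / 1000 <= c.
Proof.
move=> c0 c2; rewrite leNgt; apply/negP => h; nra.
Qed.

(** In thousandths, the constant term takes 549 and the first frequency 627 * 0.3013 < 189 of the
    allowed 750, which leaves 12 for the other three. *)
Lemma hit_le_of_products c l (e2 e3 e5 : R) : 0 < c -> c ^+ 2 = 2 / 3 ->
  \sum_(a <- l) a ^+ 2 = 1 -> (forall a, a \in l -> 0 <= a /\ a <= 1) ->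
  `|\prod_(a <- l) cos (31 / 10 * a)| <= e2 ->
  `|\prod_(a <- l) cos (93 / 20 * a)| <= e3 ->
  `|\prod_(a <- l) cos (31 / 4 * a)| <= e5 ->
  27 * e2 + 197 * e3 + 85 * e5 <= 12 ->
  sign_mean l (fun y => (`|y| < c)%R%:R) 0 <= 3 / 4.
Proof.
move=> c0 c2 l1 la h2 h3 h5 he.
(* All angles are at most 31/20 < 7/4 and the variance is 1, so the product is at most exp (-
   961/800), where 961/800 = 16 * 961/12800. *)
have h1 : `|\prod_(a <- [::] ++ l) cos (31 / 20 * a)| <= 3013 / 10000.
  apply: (@norm_prod_cos_tail_le (1 / 2) (7 / 4) _ 1 (961 / 12800)); try (clear; lra).
  - exact: norm_cos_le_expR_half.
  - by move=> a /la[a0 ab]; split=> [//|]; move: ab; clear; lra.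
  - by rewrite l1.
apply: le_trans (sign_mean_lt_le l c0 c2) _.
move: h1 h2 h3 h5; rewrite cat0s !ler_norml.
move: (\prod_(a <- l) _) (\prod_(a <- l) _) (\prod_(a <- l) _) (\prod_(a <- l) _).
move=> p1 p2 p3 p5 /andP[_ h1] /andP[h2 _] /andP[h3 _] /andP[_ h5].
by move: he h1 h2 h3 h5; clear; lra.
Qed.

(** The other coefficients are at most c - 3/5, so even the angles 31/4 * a stay below 7/4, and they
    keep a variance of at least 1 - c^2 = 1/3. *)
Lemma hit_le_large_head c a1 l : 0 < c -> c ^+ 2 = 2 / 3 ->
  3 / 5 <= a1 -> a1 <= c -> a1 ^+ 2 + \sum_(a <- l) a ^+ 2 = 1 ->
  (forall a, a \in l -> 0 <= a /\ a1 + a <= c) ->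
  sign_mean (a1 :: l) (fun y => (`|y| < c)%R%:R) 0 <= 3 / 4.
Proof.
move=> c0 c2 a1l a1c hs hl.
have cu := ub_sqrt_two_thirds c0 c2.
have hv : 1 / 3 <= \sum_(a <- l) a ^+ 2.
  have : a1 ^+ 2 <= c ^+ 2 by nra.
  rewrite c2; lra.
have hb : forall a, a \in l -> 0 <= a /\ a <= 433 / 2000.
  by move=> a /hl[a0 ab]; split=> [//|]; move: ab a1l cu; clear; lra.
apply: (@hit_le_of_products c _ (203 / 1000) (285 / 10000) (1 / 1000)) => //.
- by rewrite big_cons.
- move=> a; rewrite inE => /predU1P[->|/hb[a0 ab]].
    by move: a1l a1c cu; clear; lra.
  by split=> [//|]; move: ab; clear; lra.
- apply: (@norm_prod_cos_tail_le (1 / 2) (7 / 4) _ (1 / 3) (1 / 10) _ [:: a1])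
    hv _ _ _ _; try (clear; lra); first exact: norm_cos_le_expR_half.
  by move=> a /hb[a0 ab]; split=> [//|]; move: ab; clear; lra.
- apply: (@norm_prod_cos_tail_le (1 / 2) (7 / 4) _ (1 / 3) (225 / 1000) _ [:: a1])
    hv _ _ _ _; try (clear; lra); first exact: norm_cos_le_expR_half.
  by move=> a /hb[a0 ab]; split=> [//|]; move: ab; clear; lra.
- apply: (@norm_prod_cos_tail_le (1 / 2) (7 / 4) _ (1 / 3) (6 / 10) _ [:: a1])
    hv _ _ _ _; try (clear; lra); first exact: norm_cos_le_expR_half.
  by move=> a /hb[a0 ab]; split=> [//|]; move: ab; clear; lra.
- clear; lra.
Qed.

(** The tail has variance at least 1 - (3/5)^2, which settles frequencies 2 and 3. Frequency 5 stays
    a hypothesis: at a = c/2 its angle 31/4 * a is close to pi and the cosine gives no decay. The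
    value 17/200 is what the budget leaves for it. *)
Lemma hit_le_small_head c a1 l : 0 < c -> c ^+ 2 = 2 / 3 ->
  0 <= a1 -> a1 <= 3 / 5 -> a1 ^+ 2 + \sum_(a <- l) a ^+ 2 = 1 ->
  (forall a, a \in l -> 0 <= a /\ 2 * a <= c) ->
  `|\prod_(a <- a1 :: l) cos (31 / 4 * a)| <= 17 / 200 ->
  sign_mean (a1 :: l) (fun y => (`|y| < c)%R%:R) 0 <= 3 / 4.
Proof.
move=> c0 c2 a1l a1c hs hl h5.
have cu := ub_sqrt_two_thirds c0 c2.
have hv : 16 / 25 <= \sum_(a <- l) a ^+ 2.
  have : a1 ^+ 2 <= (3 / 5) ^+ 2 by nra.
  lra.
have hb : forall a, a \in l -> 0 <= a /\ a <= 1633 / 4000.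
  by move=> a /hl[a0 ab]; split=> [//|]; move: ab cu; clear; lra.
apply: (@hit_le_of_products c _ (48 / 1000) (17 / 1000) (17 / 200)) => //.
- by rewrite big_cons.
- move=> a; rewrite inE => /predU1P[->|/hb[a0 ab]].
    by split=> [//|]; move: a1c; clear; lra.
  by split=> [//|]; move: ab; clear; lra.
- apply: (@norm_prod_cos_tail_le (1 / 2) (7 / 4) _ (16 / 25) (192 / 1000) _ [:: a1])
    hv _ _ _ _; try (clear; lra); first exact: norm_cos_le_expR_half.
  by move=> a /hb[a0 ab]; split=> [//|]; move: ab; clear; lra.
- apply: (@norm_prod_cos_tail_le (3 / 10) (19 / 10) _ (16 / 25) (259 / 1000) _ [:: a1])
    hv _ _ _ _; try (clear; lra); first exact: norm_cos_le_expR_k3.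
  by move=> a /hb[a0 ab]; split=> [//|]; move: ab; clear; lra.
- clear; lra.
Qed.

Lemma prod5_le_half p l :
  (forall a, a \in l -> 0 <= a /\ a <= 1129 / 5000) ->
  83 / 1000 <= \sum_(a <- l) a ^+ 2 ->
  `|\prod_(a <- p ++ l) cos (31 / 4 * a)| <= 17 / 200.
Proof.
move=> hl hv.
apply: (@norm_prod_cos_tail_le (1 / 2) (7 / 4) _ _ (155 / 1000)) hv _ _ _ _;
  try (clear; lra); first exact: norm_cos_le_expR_half.
by move=> a /hl[a0 ab]; split=> [//|]; move: ab; clear; lra.
Qed.

(** Here 1633/6000 is an upper bound for c/3, the size of [a6] when a4 + a5 + a6 <= c. *)
Lemma prod5_le_k14 p l :
  (forall a, a \in l -> 0 <= a /\ a <= 1633 / 6000) ->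
  31 / 100 <= \sum_(a <- l) a ^+ 2 ->
  `|\prod_(a <- p ++ l) cos (31 / 4 * a)| <= 17 / 200.
Proof.
move=> hl hv.
apply: (@norm_prod_cos_tail_le (7 / 50) (211 / 100) _ _ (162 / 1000)) hv _ _ _ _;
  try (clear; lra); first exact: norm_cos_le_expR_k14.
by move=> a /hl[a0 ab]; split=> [//|]; move: ab; clear; lra.
Qed.

End FourierBounds.

(** * Pairing of sign patterns in the style of Littlewood and Offord *)

Section LittlewoodOfford.
Context {R : realType}.
Implicit Types (c x y s p q r z : R) (g : R -> R) (l : seq R).

Lemma sign_mean_cat l1 l2 g x :
  sign_mean (l1 ++ l2) g x = sign_mean l1 (sign_mean l2 g) x.
Proof. by elim: l1 x => [|a l1 IH] x //=; rewrite !IH. Qed.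

(** What the pairing needs of the indicator of (-c, c): points at distance at least 2c share a total
    weight of 1. Unlike being an indicator, this survives averaging over further signs. *)
Definition separated c g :=
  (forall y, 0 <= g y <= 1) /\ (forall y s, c <= s -> g (y + s) + g (y - s) <= 1).

Lemma separated_sign_mean c g l : separated c g -> separated c (sign_mean l g).
Proof.
move=> [g01 gs]; split.
  move=> y; apply/andP; split.
    rewrite -[0](sign_mean_cst l 0 y); apply: le_sign_mean => z.
    by have /andP[] := g01 z.
  rewrite -[leRHS](sign_mean_cst l 1 y); apply: le_sign_mean => z.
  by have /andP[] := g01 z.
move=> y s cs; rewrite sign_mean_shift [X in _ + X]sign_mean_shift -sign_meanD.
rewrite -[leRHS](sign_mean_cst l 1 0); apply: le_sign_mean => z.
by rewrite (addrAC y s) (addrAC y (- s)) gs.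
Qed.

Lemma separated_indicator c : 0 < c -> separated c (fun y => (`|y| < c)%R%:R).
Proof.
move=> c0; split=> [y|y s cs]; first by case: (_ < _); rewrite ?lexx ler01.
have [h1|_] := ltP `|y + s| c; last by case: (_ < _); rewrite add0r ?lexx ?ler01.
have [h2|_] := ltP `|y - s| c; last by rewrite addr0.
move: h1 h2; rewrite !ltr_norml => /andP[_ h1] /andP[h2 _]; lra.
Qed.

(* Four disjoint pairs covering the cube of signs: the two extreme points,
   and three pairs of middle points that differ in one coordinate each. *)
Lemma sign_mean3 p q r g y :
  8 * sign_mean [:: p; q; r] g y =
  (g (y + (p + q + r)) + g (y - (p + q + r)))
  + (g (y + p - r + q) + g (y + p - r - q))
  + (g (y + q - p + r) + g (y + q - p - r))
  + (g (y + r - q + p) + g (y + r - q - p)).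
Proof.
rewrite /=.
have -> : y + (p + q + r) = y + p + q + r by ring.
have -> : y - (p + q + r) = y - p - q - r by ring.
have -> : y + p - r + q = y + p + q - r by ring.
have -> : y + p - r - q = y + p - q - r by ring.
have -> : y + q - p + r = y - p + q + r by ring.
have -> : y + q - p - r = y - p + q - r by ring.
have -> : y + r - q + p = y + p - q + r by ring.
have -> : y + r - q - p = y - p - q + r by ring.
by field.
Qed.

(** In each cube of three signs the extreme pair counts once instead of twice: 7/8 for the inner
    cube, then (1 + 6 * 7/8) / 8 for the outer one. *)
Lemma sign_mean6_le c g y (a1 a2 a3 a4 a5 a6 : R) : separated c g ->
  c <= a1 + a2 + a3 -> c <= a4 + a5 + a6 ->
  sign_mean [:: a1; a2; a3; a4; a5; a6] g y <= 50 / 64.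
Proof.
move=> hg h1 h2; rewrite (sign_mean_cat [:: a1; a2; a3] [:: a4; a5; a6]).
have hG : forall u, sign_mean [:: a4; a5; a6] g u <= 7 / 8.
  move=> u; have := sign_mean3 a4 a5 a6 g u.
  case: hg => g01 gs; have := gs u _ h2.
  have /andP[_] := g01 (u + a4 - a6 + a5); have /andP[_] := g01 (u + a4 - a6 - a5).
  have /andP[_] := g01 (u + a5 - a4 + a6); have /andP[_] := g01 (u + a5 - a4 - a6).
  have /andP[_] := g01 (u + a6 - a5 + a4); have /andP[_] := g01 (u + a6 - a5 - a4).
  clear; lra.
have := sign_mean3 a1 a2 a3 (sign_mean [:: a4; a5; a6] g) y.
have [_ Gs] := separated_sign_mean [:: a4; a5; a6] hg.
have := Gs y _ h1; move: hG; move: (sign_mean [:: a4; a5; a6] g) => G hG.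
have := hG (y + a1 - a3 + a2); have := hG (y + a1 - a3 - a2).
have := hG (y + a2 - a1 + a3); have := hG (y + a2 - a1 - a3).
have := hG (y + a3 - a2 + a1); have := hG (y + a3 - a2 - a1).
clear; lra.
Qed.

Lemma separated_cube c g y p q r : separated c g -> c <= p + q + r ->
  8 * sign_mean [:: p; q; r] g y <= 7.
Proof.
move=> [g01 gs] h; rewrite sign_mean3; have := gs y _ h.
have /andP[_] := g01 (y + p - r + q); have /andP[_] := g01 (y + p - r - q).
have /andP[_] := g01 (y + q - p + r); have /andP[_] := g01 (y + q - p - r).
have /andP[_] := g01 (y + r - q + p); have /andP[_] := g01 (y + r - q - p).
clear; lra.
Qed.

(** A middle edge of the outer cube flips some [s], one of the inner cube some [t]; together with
    [z] they span a cube to which [separated_cube] applies. So two inner means differing in [s] add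
    up to at most (2 + 3 * 7/2) / 8 = 25/16, and the total is (1 + 3 * 25/16) / 8. *)
Lemma sign_mean7_le c g y (a1 a2 a3 a4 a5 a6 z : R) : separated c g ->
  c <= a1 + a2 + a3 -> c <= a4 + a5 + a6 ->
  (forall s t, s \in [:: a1; a2; a3] -> t \in [:: a4; a5; a6] -> c <= s + t + z) ->
  sign_mean [:: a1; a2; a3; a4; a5; a6] (sign_mean [:: z] g) y <= 91 / 128.
Proof.
move=> hg h1 h2 h3; rewrite (sign_mean_cat [:: a1; a2; a3] [:: a4; a5; a6]).
have hg2 := separated_sign_mean [:: z] hg.
have hG : forall u s, s \in [:: a1; a2; a3] ->
    sign_mean [:: a4; a5; a6] (sign_mean [:: z] g) (u + s) +
    sign_mean [:: a4; a5; a6] (sign_mean [:: z] g) (u - s) <= 25 / 16.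
  move=> u s hs.
  have := sign_mean3 a4 a5 a6 (sign_mean [:: z] g) (u + s).
  have := sign_mean3 a4 a5 a6 (sign_mean [:: z] g) (u - s).
  case: (hg2) => _ gs2; have := gs2 (u + s) _ h2; have := gs2 (u - s) _ h2.
  have cube t v : t \in [:: a4; a5; a6] ->
      sign_mean [:: z] g (u + s + v + t) + sign_mean [:: z] g (u + s + v - t) +
      (sign_mean [:: z] g (u - s + v + t) + sign_mean [:: z] g (u - s + v - t))
      <= 7 / 2.
    move=> ht; have := separated_cube (u + v) hg (h3 _ _ hs ht).
    rewrite /= !(addrAC u v); lra.
  have e w (x1 x2 : R) : w + x1 - x2 = w + (x1 - x2) by rewrite addrA.
  have := cube a5 (a4 - a6); have := cube a6 (a5 - a4); have := cube a4 (a6 - a5).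
  rewrite !inE !eqxx !orbT => /(_ isT) c1 /(_ isT) c2 /(_ isT) c3.
  move: c1 c2 c3; rewrite !e.
  move: (sign_mean [:: a4; a5; a6] _ _) (sign_mean [:: a4; a5; a6] _ _) => m1 m2.
  clear; move: (sign_mean [:: z] g) => G; lra.
have := sign_mean3 a1 a2 a3 (sign_mean [:: a4; a5; a6] (sign_mean [:: z] g)) y.
have [_ Gs] := separated_sign_mean [:: a4; a5; a6] hg2.
have := Gs y _ h1.
have := hG (y + a1 - a3) a2; have := hG (y + a2 - a1) a3; have := hG (y + a3 - a2) a1.
rewrite !inE !eqxx !orbT => /(_ isT) c1 /(_ isT) c2 /(_ isT) c3.
move: c1 c2 c3; move: (sign_mean [:: a4; a5; a6] _) => G; clear; lra.
Qed.

(** Equal last signs act as one coefficient a7 + a8, where the seven-coefficient bound applies since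
    a3 + a6 is the smallest mixed pair; opposite signs leave the six-coefficient bound. The average
    of 91/128 and 100/128 is 191/256. *)
Lemma sign_mean8_le c g y (a1 a2 a3 a4 a5 a6 a7 a8 : R) : separated c g ->
  a2 <= a1 -> a3 <= a2 -> a4 <= a3 -> a5 <= a4 -> a6 <= a5 ->
  c <= a4 + a5 + a6 -> c <= a3 + a6 + a7 + a8 ->
  sign_mean [:: a1; a2; a3; a4; a5; a6; a7; a8] g y <= 3 / 4.
Proof.
move=> hg h1 h2 h3 h4 h5 hc hd.
rewrite (sign_mean_cat [:: a1; a2; a3; a4; a5; a6] [:: a7; a8]).
have -> : sign_mean [:: a1; a2; a3; a4; a5; a6] (sign_mean [:: a7; a8] g) y =
  sign_mean [:: a1; a2; a3; a4; a5; a6]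
    (fun u => 1 / 2 * (sign_mean [:: a7 + a8] g u + sign_mean [:: a7 - a8] g u)) y.
  apply: eq_sign_mean => u /=; rewrite !addrA !opprD !opprK !addrA; by field.
rewrite sign_meanZ sign_meanD.
have b1 : sign_mean [:: a1; a2; a3; a4; a5; a6] (sign_mean [:: a7 + a8] g) y <= 91 / 128.
  apply: (sign_mean7_le _ hg); [lra|lra|] => s t.
  rewrite !inE => /or3P[] /eqP-> /or3P[] /eqP->; lra.
have b2 : sign_mean [:: a1; a2; a3; a4; a5; a6] (sign_mean [:: a7 - a8] g) y <= 50 / 64.
  by apply: (sign_mean6_le _ (separated_sign_mean _ hg)); lra.
by move: b1 b2; lra.
Qed.

End LittlewoodOfford.

(** * Six coefficients near c/2 carrying almost all the variance *)

Section Cluster.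
Context {R : realType}.
Implicit Types (c s u w D : R) (l : seq R).

Lemma sign_mean_symmetrize l (f : R -> R) :
  sign_mean l f 0 = 1 / 2 * sign_mean l (fun y => f y + f (- y)) 0.
Proof. by rewrite sign_meanD -(sign_mean_opp l f); field. Qed.

(** Chebyshev after symmetrizing: at most one of s + y and s - y lies in (-c, c), and then |y| > u.
    This saves a factor 2. *)
Lemma hit_far_le c u s l : 0 < u -> c + u <= s ->
  sign_mean l (fun y => (`|y| < c)%R%:R) s <=
  (\sum_(a <- l) a ^+ 2) / (2 * u ^+ 2).
Proof.
move=> u0 cs; rewrite sign_mean_shift sign_mean_symmetrize.
have h y : (`|s + y| < c)%R%:R + (`|s - y| < c)%R%:R <= (u ^+ 2)^-1 * y ^+ 2.
  have [y1|y1] := ltP `|s + y| c; have [y2|y2] := ltP `|s - y| c;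
    move: y1 y2; rewrite ?ltr_norml.
  - move=> /andP[y1 y1'] /andP[y2 y2']; lra.
  - move=> /andP[y1 y1'] _; rewrite addr0 mulrC ler_pdivlMr ?exprn_gt0//= mul1r; nra.
  - move=> _ /andP[y1 y1']; rewrite add0r mulrC ler_pdivlMr ?exprn_gt0//= mul1r; nra.
  - by move=> _ _; rewrite addr0 mulr_ge0// ?sqr_ge0// invr_ge0 sqr_ge0.
have := le_sign_mean l 0 h; rewrite sign_meanZ sign_mean_sq expr0n add0r.
have -> : (\sum_(a <- l) a ^+ 2) / (2 * u ^+ 2) =
  1 / 2 * ((u ^+ 2)^-1 * \sum_(a <- l) a ^+ 2).
  by field; rewrite gt_eqF.
by move=> h'; rewrite ler_wpM2l.
Qed.

Lemma sign_mean_biquadratic l (A B C : R) :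
  sign_mean l (fun y => A + B * y ^+ 2 + C * y ^+ 4) 0 =
  A + B * (\sum_(a <- l) a ^+ 2) + C * sign_mean l (fun y => y ^+ 4) 0.
Proof.
by rewrite !sign_meanD !sign_meanZ sign_mean_cst sign_mean_sq expr0n add0r.
Qed.

(* Paley-Zygmund, in the form E (1 - (Y^2 - D^2) / k)^2 with k = 3 E Y^2. *)
Lemma hit_near_le c D s l (w := \sum_(a <- l) a ^+ 2) : 0 <= D -> c - D <= s ->
  D ^+ 2 <= 179 / 1000 * w -> sign_mean l (fun y => (`|y| < c)%R%:R) s <= 7 / 8.
Proof.
move=> D0 cs Dw; rewrite sign_mean_shift sign_mean_symmetrize.
have w0 : 0 <= w by apply: sumr_ge0 => a _; apply: sqr_ge0.
have one y : D ^+ 2 <= y ^+ 2 ->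
    (`|s + y| < c)%R%:R + (`|s - y| < c)%R%:R <= 1 :> R.
  move=> Dy.
  have [y1|y1] := ltP `|s + y| c; have [y2|y2] := ltP `|s - y| c;
    rewrite ?addr0 ?add0r ?ler01//.
  by move: y1 y2; rewrite !ltr_norml => /andP[_ y1] /andP[_ y2]; nra.
(* If w = 0 then D = 0, so [one] applies to every y; otherwise 3 * w can be inverted. *)
have := w0; rewrite le_eqVlt => /predU1P[w00|wp].
  have D00 : D ^+ 2 = 0.
    apply/eqP; rewrite eq_le sqr_ge0 andbT; apply: le_trans Dw _.
    by rewrite -w00 mulr0.
  have h y : (`|s + y| < c)%R%:R + (`|s - y| < c)%R%:R <= 1 :> R.
    by apply: one; rewrite D00 sqr_ge0.
  have := le_sign_mean l 0 h; rewrite sign_mean_cst; lra.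
pose k := (3 * w)^-1.
have kw : k * w = 1 / 3 by rewrite /k; field; rewrite gt_eqF.
have k0 : 0 < k by rewrite /k invr_gt0; lra.
pose A := 1 + (1 + k * D ^+ 2) ^+ 2.
have h y : (`|s + y| < c)%R%:R + (`|s - y| < c)%R%:R <=
    A + (- (2 * k * (1 + k * D ^+ 2))) * y ^+ 2 + k ^+ 2 * y ^+ 4.
  have -> : A + (- (2 * k * (1 + k * D ^+ 2))) * y ^+ 2 + k ^+ 2 * y ^+ 4 =
      1 + (1 + k * (D ^+ 2 - y ^+ 2)) ^+ 2 by rewrite /A; ring.
  have [Dy|Dy] := leP (D ^+ 2) (y ^+ 2).
    by apply: le_trans (one _ Dy) _; rewrite lerDl sqr_ge0.
  have : 0 < k * (D ^+ 2 - y ^+ 2) by rewrite mulr_gt0// subr_gt0.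
  move: (k * _) => z z0.
  case: (_ < _); case: (_ < _); rewrite /=; nra.
have := le_sign_mean l 0 h; rewrite sign_mean_biquadratic -/w.
have := sign_mean_pow4_le l 0; rewrite -/w !expr0n/= mulr0 mul0r !add0r.
move: (sign_mean l (fun y => y ^+ 4) 0) => M4 hM4; move: (sign_mean _ _ _) => M hM.
have kD : k * D ^+ 2 <= 179 / 3000.
  have := ler_wpM2l (ltW k0) Dw.
  have -> : k * (179 / 1000 * w) = 179 / 1000 * (k * w) by ring.
  rewrite kw; lra.
have kD0 : 0 <= k * D ^+ 2 by rewrite mulr_ge0// ?sqr_ge0// ltW.
have k4 : k ^+ 2 * M4 <= 1 / 3.
  have -> : 1 / 3 = k ^+ 2 * (3 * w ^+ 2) :> R.
    have -> : k ^+ 2 * (3 * w ^+ 2) = 3 * (k * w) ^+ 2 by ring.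
    by rewrite kw; field.
  apply: ler_wpM2l; first exact: sqr_ge0.
  exact: hM4.
move: hM; rewrite /A.
have -> : - (2 * k * (1 + k * D ^+ 2)) * w = - (2 * (k * w) * (1 + k * D ^+ 2)) by ring.
rewrite kw; move: (k * D ^+ 2) kD kD0 (k ^+ 2 * M4) k4 => v v1 v0 m m1 hM.
(* With v = k D^2 the symmetrized mean is at most 5/3 + 4v/3 + v^2, which must not exceed 7/4: hence
   the constant 179/1000. *)
have : v ^+ 2 <= 179 / 3000 * v by nra.
move: hM v1 v0 m1; clear; lra.
Qed.

(** Only d1 may be negative. Its cross terms are absorbed by those of d2 at the price of d2^2, which
    d3 * d4 repays. *)
Lemma sqr_sum6_ge (d1 d2 d3 d4 d5 d6 : R) : 0 <= d2 -> - d2 <= d1 ->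
  d2 <= d3 -> d3 <= d4 -> d4 <= d5 -> d5 <= d6 ->
  d1 ^+ 2 + d2 ^+ 2 + d3 ^+ 2 + d4 ^+ 2 + d5 ^+ 2 + d6 ^+ 2 <=
  (d1 + d2 + d3 + d4 + d5 + d6) ^+ 2.
Proof.
move=> p2 d12 d23 d34 d45 d56.
have p3 := le_trans p2 d23; have p4 := le_trans p3 d34.
have p5 := le_trans p4 d45; have p6 := le_trans p5 d56.
have e1 : 0 <= (d1 + d2) * (d2 + d3 + d4 + d5 + d6).
  by apply: mulr_ge0; [move: d12; clear; lra|rewrite !addr_ge0].
have e2 : d2 * d2 <= d3 * d4 by rewrite ler_pM// (le_trans d23).
have e3 : 0 <= d3 * d5 + d3 * d6 + d4 * d5 + d4 * d6 + d5 * d6.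
  by rewrite !addr_ge0// mulr_ge0.
move: e1 e2 e3; clear; lra.
Qed.

(* For d in [0, c / 2], d * (c - d) >= (c / 2) * d; a negative d1 costs at most
   0.152 D because then -d1 <= D / 4. *)
Lemma deviation_le c (d1 d2 d3 d4 d5 d6 : R) (D := d1 + d2 + d3 + d4 + d5 + d6) :
  816 / 1000 <= c -> c <= 1633 / 2000 ->
  0 <= d2 -> - d2 <= d1 -> - (193 / 1000) <= d1 ->
  d1 <= d2 -> d2 <= d3 -> d3 <= d4 -> d4 <= d5 -> d5 <= d6 -> d6 <= c / 2 ->
  1 / 4 * D <=
  c * D - (d1 ^+ 2 + d2 ^+ 2 + d3 ^+ 2 + d4 ^+ 2 + d5 ^+ 2 + d6 ^+ 2).
Proof.
move=> cl cu p2 d12 d1c d21 d23 d34 d45 d56 u6.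
have p3 := le_trans p2 d23; have p4 := le_trans p3 d34.
have p5 := le_trans p4 d45; have p6 := le_trans p5 d56.
have u5 := le_trans d56 u6; have u4 := le_trans d45 u5.
have u3 := le_trans d34 u4; have u2 := le_trans d23 u3; have u1 := le_trans d21 u2.
have D0 : 0 <= D by rewrite /D; move: d12 p3 p4 p5 p6; clear; lra.
have D4 : - D / 4 <= d1 by rewrite /D; move: d12 d23 d34 d45 d56; clear; lra.
have f x : 0 <= x -> x <= c / 2 -> c / 2 * x <= c * x - x ^+ 2.
  clear => x0 xc.
  have : 0 <= x * (c / 2 - x) by rewrite mulr_ge0// subr_ge0.
  lra.
have f1 : c / 2 * d1 - 152 / 1000 * D <= c * d1 - d1 ^+ 2.
  have [d10|d10] := leP 0 d1.
    by have := f _ d10 u1; move: D0; clear; lra.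
  have n1 : 0 <= - d1 by rewrite oppr_ge0 ltW.
  have : 0 <= (- d1) * (d1 + 193 / 1000).
    by apply: mulr_ge0; [exact: n1|move: d1c; clear; lra].
  have : 0 <= (- d1) * (1633 / 2000 - c).
    by apply: mulr_ge0; [exact: n1|rewrite subr_ge0; exact: cu].
  move: D4 D0 n1; move: (D); clear => x; lra.
have f2 := f _ p2 u2; have f3 := f _ p3 u3; have f4 := f _ p4 u4.
have f5 := f _ p5 u5; have f6 := f _ p6 u6.
have h : c / 2 * D - 152 / 1000 * D <=
  c * D - (d1 ^+ 2 + d2 ^+ 2 + d3 ^+ 2 + d4 ^+ 2 + d5 ^+ 2 + d6 ^+ 2).
  move: f1 f2 f3 f4 f5 f6; rewrite /D; clear; lra.
apply: le_trans h; have : 0 <= (c - 816 / 1000) * D.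
  by apply: mulr_ge0; [rewrite subr_ge0; exact: cl|exact: D0].
move: D0; move: (D); clear => x; lra.
Qed.

(** Put d_i = c/2 - a_i. As 6 (c/2)^2 = 1, the remaining variance is w = c D - sum d_i^2, so
    [sqr_sum6_ge] gives D (c - D) <= w and [deviation_le] gives D/4 <= w. *)
Lemma sorted6_cluster c w (a1 a2 a3 a4 a5 a6 : R)
    (D := 3 * c - (a1 + a2 + a3 + a4 + a5 + a6)) :
  0 < c -> c ^+ 2 = 2 / 3 -> 0 <= w -> w <= 85 / 1000 ->
  a2 <= a1 -> a3 <= a2 -> a4 <= a3 -> a5 <= a4 -> a6 <= a5 -> 0 <= a6 ->
  a1 <= 3 / 5 -> a1 + a2 <= c ->
  a1 ^+ 2 + a2 ^+ 2 + a3 ^+ 2 + a4 ^+ 2 + a5 ^+ 2 + a6 ^+ 2 + w = 1 ->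
  [/\ 0 <= D, D <= 247 / 2000, D ^+ 2 <= 179 / 1000 * w & a1 <= c / 2 + D / 4].
Proof.
move=> c0 c2 w0 w1 h1 h2 h3 h4 h5 h6 a1u hc hs.
have cl := lb_sqrt_two_thirds c0 c2; have cu := ub_sqrt_two_thirds c0 c2.
pose d1 := c / 2 - a1; pose d2 := c / 2 - a2; pose d3 := c / 2 - a3.
pose d4 := c / 2 - a4; pose d5 := c / 2 - a5; pose d6 := c / 2 - a6.
have wE : w = c * D - (d1 ^+ 2 + d2 ^+ 2 + d3 ^+ 2 + d4 ^+ 2 + d5 ^+ 2 + d6 ^+ 2).
  have : 3 / 2 * c ^+ 2 = 1 by rewrite c2; field.
  rewrite /D /d1 /d2 /d3 /d4 /d5 /d6 => c2'.
  move: hs c2'; clear; lra.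
have DE : D = d1 + d2 + d3 + d4 + d5 + d6.
  by rewrite /D /d1 /d2 /d3 /d4 /d5 /d6; field.
have p2 : 0 <= d2 by rewrite /d2; move: h1 hc; clear; lra.
have d12 : - d2 <= d1 by rewrite /d1 /d2; move: hc; clear; lra.
have d1c : - (193 / 1000) <= d1 by rewrite /d1; move: a1u cl; clear; lra.
have u6 : d6 <= c / 2 by rewrite /d6 lerBlDr lerDl.
have [d21 d23 d34 d45 d56] : [/\ d1 <= d2, d2 <= d3, d3 <= d4, d4 <= d5 & d5 <= d6].
  by split; rewrite lerD2l lerN2.
have sqD := sqr_sum6_ge p2 d12 d23 d34 d45 d56.
have wD := deviation_le cl cu p2 d12 d1c d21 d23 d34 d45 d56 u6.
have D4 : - D / 4 <= d1 by rewrite DE; move: d12 d23 d34 d45 d56; clear; lra.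
move: sqD wD; rewrite -DE -wE => sqD wD.
have D0 : 0 <= D.
  by rewrite DE; move: p2 d12 d23 d34 d45 d56; clear; lra.
have a1D : a1 <= c / 2 + D / 4 by move: D4; rewrite /d1; move: (D); clear => D; lra.
have Dc : D * (c - D) <= w by move: sqD; rewrite wE; move: (D) => D'; clear; lra.
move: D0 wD Dc a1D; move: D {DE wE sqD D4} => D D0 wD Dc a1D.
have D34 : D <= 34 / 100 by move: wD w1; clear; lra.
(* The crude bound D <= 34/100 excludes the large solutions of the quadratic inequality D (c - D) <=
   85/1000. *)
have Du : D <= 247 / 2000.
  rewrite leNgt; apply/negP => Dl.
  have : 0 <= (D - 247 / 2000) * (34 / 100 - D).
    by apply: mulr_ge0; rewrite subr_ge0; [exact: ltW|exact: D34].
  have : 0 <= D * (c - 816 / 1000).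
    by apply: mulr_ge0; [exact: D0|rewrite subr_ge0; exact: cl].
  move: Dl Dc w1; clear; lra.
split; [exact: D0|exact: Du| |exact: a1D].
have : D * (6925 / 10000) <= w.
  apply: le_trans Dc; apply: ler_wpM2l; first exact: D0.
  by move: cl Du; clear; lra.
have : 0 <= D * (247 / 2000 - D).
  by apply: mulr_ge0; [exact: D0|rewrite subr_ge0; exact: Du].
move: w0 D0; clear; lra.
Qed.

(* Of the 64 sign patterns of a1, ..., a6, the 14 with at most one minority sign
   hit with probability at most 1/8 and the 30 with two at most 7/8. *)
Lemma hit_cluster_le c l (a1 a2 a3 a4 a5 a6 : R) :
  0 < c -> c ^+ 2 = 2 / 3 -> \sum_(a <- l) a ^+ 2 <= 85 / 1000 ->
  a2 <= a1 -> a3 <= a2 -> a4 <= a3 -> a5 <= a4 -> a6 <= a5 -> 0 <= a6 ->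
  a1 <= 3 / 5 -> a1 + a2 <= c ->
  a1 ^+ 2 + a2 ^+ 2 + a3 ^+ 2 + a4 ^+ 2 + a5 ^+ 2 + a6 ^+ 2 + \sum_(a <- l) a ^+ 2 = 1 ->
  sign_mean [:: a1, a2, a3, a4, a5, a6 & l] (fun y => (`|y| < c)%R%:R) 0 <= 3 / 4.
Proof.
move=> c0 c2 w1 h1 h2 h3 h4 h5 h6 a1u hc hs.
have w0 : 0 <= \sum_(a <- l) a ^+ 2 by apply: sumr_ge0 => a _; apply: sqr_ge0.
have [D0 Du Dw a1D] := sorted6_cluster c0 c2 w0 w1 h1 h2 h3 h4 h5 h6 a1u hc hs.
have cl := lb_sqrt_two_thirds c0 c2.
rewrite (sign_mean_cat [:: a1; a2; a3; a4; a5; a6] l).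
set g := sign_mean l _.
have gN x : g (- x) = g x by apply: sign_mean_even => y; rewrite normrN.
have g1 x : g x <= 1.
  by have [/(_ x) /andP[]] := separated_sign_mean l (separated_indicator c0).
(* Chebyshev with u = 6/10: 0.085 / (2 * 0.36) < 1/8. *)
have far x : c + 6 / 10 <= x -> g x <= 1 / 8.
  move=> hx; apply: le_trans (hit_far_le l _ hx) _; first (clear; lra).
  rewrite ler_pdivrMr; first (move: w1; clear; lra).
  clear; lra.
have near x : c - (3 * c - (a1 + a2 + a3 + a4 + a5 + a6)) <= x -> g x <= 7 / 8.
  by move=> hx; apply: hit_near_le hx Dw.
clear w0 Dw hs w1 h6 c2 a1u.
pose S := a1 + a2 + a3 + a4 + a5 + a6.
(* Flipping one sign leaves at least 3c - D - 2 (c/2 + D/4) = 2c - 3D/2, still above c + 6/10. *)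
have far' j : j <= a1 -> g (S - 2 * j) <= 1 / 8.
  by move=> hj; apply: far; rewrite /S; move: hj cl Du a1D; clear; lra.
have near' j k : j + k <= c -> g (S - 2 * (j + k)) <= 7 / 8.
  by move=> hj; apply: near; rewrite /S; move: hj; clear; lra.
have F0 : g S <= 1 / 8 by apply: far; rewrite /S; move: cl Du; clear; lra.
have F1 : g (S - 2 * a1) <= 1 / 8 by apply: far'; move: h1 h2 h3 h4 h5; clear; lra.
have F2 : g (S - 2 * a2) <= 1 / 8 by apply: far'; move: h1 h2 h3 h4 h5; clear; lra.
have F3 : g (S - 2 * a3) <= 1 / 8 by apply: far'; move: h1 h2 h3 h4 h5; clear; lra.
have F4 : g (S - 2 * a4) <= 1 / 8 by apply: far'; move: h1 h2 h3 h4 h5; clear; lra.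
have F5 : g (S - 2 * a5) <= 1 / 8 by apply: far'; move: h1 h2 h3 h4 h5; clear; lra.
have F6 : g (S - 2 * a6) <= 1 / 8 by apply: far'; move: h1 h2 h3 h4 h5; clear; lra.
pose s3 := sign_mean [:: a4; a5; a6] g.
have Qpp : s3 (a1 + a2 + a3) <= (4 * (1 / 8) + 3 * (7 / 8) + 1) / 8.
  rewrite /s3/=.
  have -> : a1 + a2 + a3 + a4 + a5 + a6 = S by [].
  have -> : a1 + a2 + a3 + a4 + a5 - a6 = S - 2 * a6 by rewrite /S; ring.
  have -> : a1 + a2 + a3 + a4 - a5 + a6 = S - 2 * a5 by rewrite /S; ring.
  have -> : a1 + a2 + a3 - a4 + a5 + a6 = S - 2 * a4 by rewrite /S; ring.
  have -> : a1 + a2 + a3 + a4 - a5 - a6 = S - 2 * (a5 + a6) by rewrite /S; ring.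
  have -> : a1 + a2 + a3 - a4 + a5 - a6 = S - 2 * (a4 + a6) by rewrite /S; ring.
  have -> : a1 + a2 + a3 - a4 - a5 + a6 = S - 2 * (a4 + a5) by rewrite /S; ring.
  have n1 : g (S - 2 * (a5 + a6)) <= 7 / 8.
    by apply: near'; move: h1 h2 h3 h4 h5 hc; clear; lra.
  have n2 : g (S - 2 * (a4 + a6)) <= 7 / 8.
    by apply: near'; move: h1 h2 h3 h4 h5 hc; clear; lra.
  have n3 : g (S - 2 * (a4 + a5)) <= 7 / 8.
    by apply: near'; move: h1 h2 h3 h4 h5 hc; clear; lra.
  have := g1 (a1 + a2 + a3 - a4 - a5 - a6).
  move: F0 F4 F5 F6 n1 n2 n3; clear; lra.
have Qm i j k : i + j + k = a1 + a2 + a3 -> j + k <= c ->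
    (forall x, x \in [:: a4; a5; a6] -> i + x <= c) ->
    g (S - 2 * i) <= 1 / 8 ->
    s3 (a1 + a2 + a3 - 2 * i) <= (1 / 8 + 3 * (7 / 8) + 3 + 7 / 8) / 8.
  move=> ijkE jkc ij Fi; rewrite /s3/=.
  have -> : a1 + a2 + a3 - 2 * i + a4 + a5 + a6 = S - 2 * i by rewrite /S; ring.
  have -> : a1 + a2 + a3 - 2 * i + a4 + a5 - a6 = S - 2 * (i + a6) by rewrite /S; ring.
  have -> : a1 + a2 + a3 - 2 * i + a4 - a5 + a6 = S - 2 * (i + a5) by rewrite /S; ring.
  have -> : a1 + a2 + a3 - 2 * i - a4 + a5 + a6 = S - 2 * (i + a4) by rewrite /S; ring.
  have n1 : g (S - 2 * (i + a6)) <= 7 / 8 by apply/near'/ij; rewrite !inE eqxx !orbT.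
  have n2 : g (S - 2 * (i + a5)) <= 7 / 8 by apply/near'/ij; rewrite !inE eqxx !orbT.
  have n3 : g (S - 2 * (i + a4)) <= 7 / 8 by apply/near'/ij; rewrite !inE eqxx.
  (* Flipping [i] and the last three signs mirrors flipping just [j] and [k]. *)
  have n4 : g (a1 + a2 + a3 - 2 * i - a4 - a5 - a6) <= 7 / 8.
    rewrite -gN.
    have -> : - (a1 + a2 + a3 - 2 * i - a4 - a5 - a6) = S - 2 * (j + k).
      by rewrite /S -ijkE; ring.
    exact: near'.
  have := g1 (a1 + a2 + a3 - 2 * i + a4 - a5 - a6).
  have := g1 (a1 + a2 + a3 - 2 * i - a4 + a5 - a6).
  have := g1 (a1 + a2 + a3 - 2 * i - a4 - a5 + a6).
  move: Fi n1 n2 n3 n4; clear; lra.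
have h13 := le_trans h2 h1.
have tail_le x : x \in [:: a4; a5; a6] -> x <= a2.
  by rewrite !inE => /or3P[] /eqP->; move: h2 h3 h4 h5; clear; lra.
have pair i x : i <= a1 -> x \in [:: a4; a5; a6] -> i + x <= c.
  by move=> ia1 /tail_le xa2; apply: le_trans hc; apply: lerD.
have Q1 : s3 (a1 + a2 + a3 - 2 * a1) <= (1 / 8 + 3 * (7 / 8) + 3 + 7 / 8) / 8.
  apply: (Qm a1 a2 a3) => [||x|]; [ring| |exact: pair|exact: F1].
  by move: h1 h2 hc; clear; lra.
have Q2 : s3 (a1 + a2 + a3 - 2 * a2) <= (1 / 8 + 3 * (7 / 8) + 3 + 7 / 8) / 8.
  apply: (Qm a2 a1 a3) => [||x|]; [ring| |exact: pair|exact: F2].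
  by move: h2 hc; clear; lra.
have Q3 : s3 (a1 + a2 + a3 - 2 * a3) <= (1 / 8 + 3 * (7 / 8) + 3 + 7 / 8) / 8.
  by apply: (Qm a3 a1 a2) => [||x|]; [ring|exact: hc|exact: pair|exact: F3].
have s3N x : s3 (- x) = s3 x by apply: sign_mean_even.
rewrite (sign_mean_cat [:: a1; a2; a3] [:: a4; a5; a6]) -/s3 /= !add0r.
have -> : - a1 + a2 + a3 = a1 + a2 + a3 - 2 * a1 by ring.
have -> : a1 - a2 + a3 = a1 + a2 + a3 - 2 * a2 by ring.
have -> : a1 + a2 - a3 = a1 + a2 + a3 - 2 * a3 by ring.
have -> : - a1 - a2 - a3 = - (a1 + a2 + a3) by ring.
have -> : a1 - a2 - a3 = - (a1 + a2 + a3 - 2 * a1) by ring.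
have -> : - a1 + a2 - a3 = - (a1 + a2 + a3 - 2 * a2) by ring.
have -> : - a1 - a2 + a3 = - (a1 + a2 + a3 - 2 * a3) by ring.
(* The count is exact: 14 * 1/8 + 30 * 7/8 + 20 = 48 out of 64. *)
rewrite !s3N; move: Qpp Q1 Q2 Q3; clear; lra.
Qed.

End Cluster.

(** * Variance left in the tail, and the case analysis *)

Section HitProbability.
Context {R : realType}.
Implicit Types (c : R) (l : seq R).

(** At a1 = c - a2 the left side is a convex quadratic in a2 equal to 1/2 at both c/6 and c/2; below
    c/6 the bound a1 <= 3/5 suffices. *)
Lemma head2_sqr_le c (a1 a2 : R) : c ^+ 2 = 2 / 3 -> 0 <= a1 -> 0 <= a2 ->
  a1 <= 3 / 5 -> a2 <= c / 2 -> a1 + a2 <= c -> a1 ^+ 2 + 2 * a2 ^+ 2 <= 1 / 2.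
Proof.
move=> c2 a10 a20 a1u a2u hc.
have [a2c|a2c] := leP (c / 6) a2.
  have h1 : 0 <= (c / 2 - a2) * (3 * a2 - c / 2).
    by apply: mulr_ge0; move: a2c a2u; clear; lra.
  have h2 : a1 ^+ 2 <= (c - a2) ^+ 2.
    by rewrite ler_sqr ?nnegrE//; move: hc a10; clear; lra.
  by move: h1 h2 c2; clear; lra.
have h1 : a1 ^+ 2 <= (3 / 5) ^+ 2 by rewrite ler_sqr ?nnegrE//; clear; lra.
have h2 : a2 ^+ 2 <= (c / 6) ^+ 2.
  by rewrite ler_sqr ?nnegrE ?(ltW a2c)// (le_trans a20)// ltW.
by move: h1 h2 c2; clear; lra.
Qed.

(** [head2_sqr_le] bounds the first three squares by 1/2. The last two add 2 (c/2)^2 = 1/3, or, for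
    large a6, by convexity at most their value at a5 = 1129/5000, a4 = c - 2 a5, which is below
    19/100. *)
Lemma sum5_sqr_le c (a1 a2 a3 a4 a5 a6 : R) : 0 < c -> c ^+ 2 = 2 / 3 ->
  a2 <= a1 -> a3 <= a2 -> a4 <= a3 -> a5 <= a4 -> a6 <= a5 -> 0 <= a6 ->
  a1 <= 3 / 5 -> a1 + a2 <= c -> a4 + a5 + a6 <= c ->
  a1 ^+ 2 + a2 ^+ 2 + a3 ^+ 2 + a4 ^+ 2 + a5 ^+ 2 <= 5 / 6 /\
  (1129 / 5000 <= a6 ->
   a1 ^+ 2 + a2 ^+ 2 + a3 ^+ 2 + a4 ^+ 2 + a5 ^+ 2 <= 69 / 100).
Proof.
move=> c0 c2 h1 h2 h3 h4 h5 p6 a1u hc h456.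
have p5 := le_trans p6 h5; have p4 := le_trans p5 h4; have p3 := le_trans p4 h3.
have p2 := le_trans p3 h2; have p1 := le_trans p2 h1.
have u2 : a2 <= c / 2 by move: h1 hc; clear; lra.
have h12 := head2_sqr_le c2 p1 p2 a1u u2 hc.
have h23 : a3 ^+ 2 <= a2 ^+ 2 by rewrite ler_sqr ?nnegrE.
split.
  have c20 : 0 <= c / 2 by rewrite divr_ge0// ltW.
  have u4 : a4 ^+ 2 <= (c / 2) ^+ 2.
    by rewrite ler_sqr ?nnegrE//; move: u2 h2 h3; clear; lra.
  have u5 : a5 ^+ 2 <= (c / 2) ^+ 2.
    by rewrite ler_sqr ?nnegrE//; move: u2 h2 h3 h4; clear; lra.
  by move: u4 u5 h12 h23 c2; clear; lra.
move=> a6l; have cu := ub_sqrt_two_thirds c0 c2.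
have h45 : a4 ^+ 2 + a5 ^+ 2 <= 19 / 100.
  have q5 : 0 <= (a5 - 1129 / 5000) * (a4 - a5).
    by apply: mulr_ge0; move: h4 h5 a6l; clear; lra.
  have q4 : 0 <= (1633 / 2000 - 1129 / 5000 - a4 - a5) * (a4 + a5 - 1129 / 5000).
    by apply: mulr_ge0; move: h4 h5 a6l h456 cu; clear; lra.
  move: q4 q5 a6l h4 h5 h456 cu; clear; nra.
by move: h45 h12 h23; clear; lra.
Qed.

(** Convexity pushes (a1, a2) to (c - a3, a3) and (a6, a7) to (c - m - a3, m), which leaves a
    quadratic in a3 on [m, 73/200]. *)
Lemma sum7_sqr_le c (a1 a2 a3 a4 a5 a6 a7 : R) : 0 < c -> c ^+ 2 = 2 / 3 ->
  a2 <= a1 -> a3 <= a2 -> a4 <= a3 -> a5 <= a4 -> a6 <= a5 -> a7 <= a6 ->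
  a1 + a2 <= c -> a3 + a6 + a7 <= c -> 1129 / 5000 <= a7 ->
  a1 ^+ 2 + a2 ^+ 2 + a3 ^+ 2 + a4 ^+ 2 + a5 ^+ 2 + a6 ^+ 2 + a7 ^+ 2 <= 9 / 10.
Proof.
move=> c0 c2 h1 h2 h3 h4 h5 h6 hc h367 a7l.
have cu := ub_sqrt_two_thirds c0 c2.
have p7 : 0 <= a7 by move: a7l; clear; lra.
have p6 := le_trans p7 h6.
have p5 := le_trans p6 h5; have p4 := le_trans p5 h4; have p3 := le_trans p4 h3.
have p2 := le_trans p3 h2; have p1 := le_trans p2 h1.
have s4 : a4 ^+ 2 <= a3 ^+ 2 by rewrite ler_sqr ?nnegrE.
have s5 : a5 ^+ 2 <= a3 ^+ 2 by rewrite ler_sqr ?nnegrE// (le_trans h4).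
have s12 : a1 ^+ 2 + a2 ^+ 2 <= (c - a3) ^+ 2 + a3 ^+ 2.
  have s1 : a1 ^+ 2 <= (c - a2) ^+ 2.
    by rewrite ler_sqr ?nnegrE//; move: hc p1; clear; lra.
  have : 0 <= (a2 - a3) * (c - a2 - a3).
    by apply: mulr_ge0; move: h1 h2 hc; clear; lra.
  by move: s1; clear; lra.
pose m : R := 1129 / 5000.
have s67 : a6 ^+ 2 + a7 ^+ 2 <= m ^+ 2 + (c - m - a3) ^+ 2.
  have s6 : a6 ^+ 2 <= (c - a3 - a7) ^+ 2.
    by rewrite ler_sqr ?nnegrE//; move: h367 p6; clear; lra.
  have : 0 <= (a7 - m) * (c - a3 - a7 - m).
    by rewrite /m; apply: mulr_ge0; move: h367 h6 a7l; clear; lra.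
  by move: s6; clear; lra.
have l3 : m <= a3 by move: h3 h4 h5 h6 a7l; rewrite /m; clear; lra.
have u3 : a3 <= 73 / 200.
  by move: h367 h6 a7l cu; clear; lra.
have : 0 <= (a3 - m) * (73 / 200 - a3).
  by apply: mulr_ge0; move: l3 u3; clear; lra.
have : 0 <= c * a3 by apply: mulr_ge0 => //; apply: ltW.
have cl := lb_sqrt_two_thirds c0 c2.
have : 0 <= (c - 816 / 1000) * a3.
  by apply: mulr_ge0; [rewrite subr_ge0; exact: cl|exact: p3].
move: s4 s5 s12 s67 l3 u3 c2 cl; rewrite /m; clear; lra.
Qed.

Lemma hit_le_sum2 c (a1 a2 : R) l : 0 < c -> c <= a1 + a2 ->
  sign_mean [:: a1, a2 & l] (fun y => (`|y| < c)%R%:R) 0 <= 3 / 4.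
Proof.
move=> c0 hc; rewrite (sign_mean_cat [:: a1; a2] l).
have [] := separated_sign_mean l (separated_indicator c0).
move: (sign_mean l _) => g g01 gs; rewrite /= !add0r.
have := gs 0 _ hc; rewrite add0r sub0r opprD.
have /andP[_] := g01 (a1 - a2); have /andP[_] := g01 (- a1 + a2).
clear; lra.
Qed.

Lemma hit_le c (a1 a2 a3 a4 a5 a6 a7 a8 : R) l : 0 < c -> c ^+ 2 = 2 / 3 ->
  a2 <= a1 -> a3 <= a2 -> a4 <= a3 -> a5 <= a4 -> a6 <= a5 -> a7 <= a6 ->
  a8 <= a7 -> 0 <= a8 -> (forall a, a \in l -> 0 <= a /\ a <= a8) ->
  \sum_(a <- [:: a1, a2, a3, a4, a5, a6, a7, a8 & l]) a ^+ 2 = 1 ->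
  sign_mean [:: a1, a2, a3, a4, a5, a6, a7, a8 & l]
    (fun y => (`|y| < c)%R%:R) 0 <= 3 / 4.
Proof.
move=> c0 c2 h1 h2 h3 h4 h5 h6 h7 p8 hl hs.
have p7 := le_trans p8 h7; have p6 := le_trans p7 h6; have p5 := le_trans p6 h5.
have p4 := le_trans p5 h4; have p3 := le_trans p4 h3.
have p2 := le_trans p3 h2; have p1 := le_trans p2 h1.
have l8 a : a \in a8 :: l -> 0 <= a /\ a <= a8 by rewrite inE => /predU1P[->|/hl].
have up (x y : R) (r : seq R) : x <= y -> 0 <= y ->
    (forall a : R, a \in r -> 0 <= a /\ a <= x) ->
    forall a, a \in y :: r -> 0 <= a /\ a <= y.
  move=> xy y0 hr a; rewrite inE => /predU1P[->|/hr[a0 ax]]; split=> //.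
  exact: le_trans xy.
have l7 := up _ _ _ h7 p7 l8; have l6 := up _ _ _ h6 p6 l7.
have l5 := up _ _ _ h5 p5 l6; have l4 := up _ _ _ h4 p4 l5.
have l3 := up _ _ _ h3 p3 l4; have l2 := up _ _ _ h2 p2 l3.
have [hc|/ltW hc] := leP c (a1 + a2); first exact: hit_le_sum2.
have [a1l|/ltW a1u] := leP (3 / 5) a1.
  apply: hit_le_large_head => //.
  - by apply: le_trans hc; rewrite lerDl.
  - by rewrite -hs [RHS]big_cons.
  - by move=> a /l2[a0 au]; split=> //; apply: le_trans hc; rewrite lerD2l.
have u2 : 2 * a2 <= c by move: h1 hc; clear; lra.
have small : `|\prod_(a <- [:: a1, a2, a3, a4, a5, a6, a7, a8 & l]) cos (31 / 4 * a)|
    <= 17 / 200 ->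
    sign_mean [:: a1, a2, a3, a4, a5, a6, a7, a8 & l]
      (fun y => (`|y| < c)%R%:R) 0 <= 3 / 4.
  move=> h; apply: hit_le_small_head => //; first by rewrite -hs [RHS]big_cons.
  move=> a /l2[a0 au]; split=> //; apply: le_trans u2.
  by rewrite ler_pM2l.
have weaken (u x : R) (r : seq R) : x <= u -> (forall a, a \in r -> 0 <= a /\ a <= x) ->
    forall a, a \in r -> 0 <= a /\ a <= u.
  by move=> xu hr a /hr[a0 ax]; split=> //; apply: le_trans xu.
have cu := ub_sqrt_two_thirds c0 c2.
move: hs; rewrite !big_cons; set w := \sum_(_ <- _) _ => hs.
have [h456|/ltW h456] := leP c (a4 + a5 + a6); last first.
  have [s5 s5'] := sum5_sqr_le c0 c2 h1 h2 h3 h4 h5 p6 a1u hc h456.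
  (* Small a6: the tail from a6 on keeps 1/6 of the variance. Otherwise it keeps 31/100, and a6 <=
     c/3. *)
  apply: small; have [a6l|a6u] := leP a6 (1129 / 5000).
    apply: (@prod5_le_half R [:: a1; a2; a3; a4; a5] [:: a6, a7, a8 & l]).
      exact: (weaken _ _ _ a6l l6).
    by rewrite !big_cons -/w; move: hs s5; clear; lra.
  apply: (@prod5_le_k14 R [:: a1; a2; a3; a4; a5] [:: a6, a7, a8 & l]).
    apply: weaken l6; move: h4 h5 h456 cu; clear; lra.
  by rewrite !big_cons -/w; move: hs (s5' (ltW a6u)); clear; lra.
have [h8|/ltW h8] := leP c (a3 + a6 + a7 + a8).
  rewrite (sign_mean_cat [:: a1; a2; a3; a4; a5; a6; a7; a8] l).
  exact: (sign_mean8_le _ (separated_sign_mean l (separated_indicator c0))).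
have [w85|/ltW w85] := leP (\sum_(a <- [:: a7, a8 & l]) a ^+ 2) (85 / 1000).
  apply: hit_cluster_le => //.
  by move: hs; rewrite !big_cons -/w; clear; lra.
apply: small; have [a7l|/ltW a7u] := leP a7 (1129 / 5000).
  apply: (@prod5_le_half R [:: a1; a2; a3; a4; a5; a6] [:: a7, a8 & l]).
    exact: (weaken _ _ _ a7l l7).
  by apply: le_trans w85; clear; lra.
(* Now a3, a6 and a7 are at least 1129/5000, so a3 + a6 + a7 + a8 <= c makes a8 small, while
   [sum7_sqr_le] leaves a tenth of the variance. *)
apply: (@prod5_le_half R [:: a1; a2; a3; a4; a5; a6; a7] [:: a8 & l]).
  by apply: weaken l8; move: h3 h4 h5 h6 h8 a7u cu; clear; lra.
have h367 : a3 + a6 + a7 <= c by apply: le_trans h8; rewrite lerDl.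
have := sum7_sqr_le c0 c2 h1 h2 h3 h4 h5 h6 hc h367 a7u.
by rewrite !big_cons -/w; move: hs; clear; lra.
Qed.

End HitProbability.

(** * From sign averages to the probability space *)

Section SignEvents.
Context {d : measure_display} {T : measurableType d} {R : realType}.
Context {P : probability T R} {n : nat} (a : 'I_n -> R) (eps : 'I_n -> {RV P >-> R}).
Context (heps : forall i : 'I_n, random_sign (eps i)) (hind : mutually_independent eps).
Implicit Types (J : {set 'I_n}) (s : 'I_n -> R).

Definition sign_event J s : set T := \bigcap_(i in [set` J]) (eps i @^-1` [set s i]).

Lemma measurable_sign_event J s : measurable (sign_event J s).
Proof.
exact: fin_bigcap_measurable.
Qed.

Lemma prob_sign_event J s : (forall i, s i = 1 \/ s i = -1) ->
  P (sign_event J s) = ((2^-1) ^+ #|J|)%:E.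
Proof.
move=> hs; rewrite /sign_event (hind _ (B := fun i => [set s i]))//.
rewrite (eq_bigr (fun=> (2^-1)%:E)); last first.
  by move=> i _; have [h1 h2] := heps i; case: (hs i) => ->.
by rewrite prodEFin prodr_const.
Qed.

Let X t := \sum_(i < n) a i * eps i t.

(** Signs in [J] are fixed, those in [l] still free; each induction step fixes one more and splits
    the event into two disjoint parts. A random sign may take other values on a null set, so the
    parts only give a lower bound. *)
Lemma sign_mean_le_prob (c : R) (E : set T) (l : seq 'I_n) J s :
  measurable E -> (forall t, c <= `|X t| -> E t) ->
  (forall i, s i = 1 \/ s i = -1) -> uniq l -> J = [set i | i \notin l]%SET ->
  (((2^-1) ^+ #|J| *
     sign_mean (map a l) (fun y => (c <= `|y|)%R%:R) (\sum_(i in J) a i * s i))%:E <=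
    P (E `&` sign_event J s))%E.
Proof.
move=> mE hE; elim: l J s => [|i l IH] J s hs /=.
  move=> _ JE; have {}JE : J = [set: 'I_n]%SET by rewrite JE; apply/setP => i; rewrite !inE.
  case: (boolP (c <= `|\sum_(i in J) a i * s i|)) => [h|_]; last by rewrite mulr0n mulr0 measure_ge0.
  rewrite mulr1n mulr1 -(prob_sign_event _ hs) setIidr// => t evt; apply: hE.
  congr (_ <= `| _ |): h; rewrite JE; apply: eq_big => [i|i _]; rewrite ?inE//.
  by congr (_ * _); apply/esym/evt; rewrite /= JE inE.
move=> /andP[il ul] JE.
pose sx x j := if j == i then x else s j.
have iJ : i \notin J by rewrite JE !inE eqxx.
have J'E : (i |: J)%SET = [set i | i \notin l]%SET.
  apply/setP => j; rewrite JE !inE negb_or; by have [->|] := eqVneq j i.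
have sxs x : x = 1 \/ x = -1 -> forall j, sx x j = 1 \/ sx x j = -1.
  by move=> hx j; rewrite /sx; case: eqP.
have sum_sx x : \sum_(j in (i |: J)%SET) a j * sx x j = \sum_(j in J) a j * s j + a i * x.
  rewrite big_setU1//= addrC {2}/sx eqxx; congr (_ + _).
  by apply: eq_bigr => j jJ; rewrite /sx; case: eqP => // ji; rewrite -ji jJ in iJ.
have hp := IH _ _ (sxs 1 (or_introl erefl)) ul J'E.
have hm := IH _ _ (sxs (-1) (or_intror erefl)) ul J'E.
have sub x : sign_event (i |: J)%SET (sx x) `<=` sign_event J s.
  move=> t h j /= jJ; have := h j; rewrite /= /sx; case: eqP => [ji|_].
    by rewrite -ji jJ in iJ.
  by apply; rewrite inE jJ orbT.
have mev x : measurable (E `&` sign_event (i |: J)%SET (sx x)).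
  by apply: measurableI => //; exact: measurable_sign_event.
apply: (@le_trans _ _ (P (E `&` sign_event (i |: J)%SET (sx 1) `|`
                          E `&` sign_event (i |: J)%SET (sx (-1))))); last first.
  apply: le_measure; rewrite ?inE.
  - exact: measurableU.
  - by apply: measurableI => //; exact: measurable_sign_event.
  - by move=> t [[Et /sub]|[Et /sub]].
rewrite measureU//; last first.
  rewrite -subset0 => t [[_ /(_ i)] + [_ /(_ i)]].
  rewrite /= !inE eqxx /sx eqxx => /(_ isT) -> /(_ isT)/eqP.
  by rewrite gt_eqF// (lt_trans ltrN10 ltr01).
apply: le_trans (leeD hp hm); rewrite -EFinD lee_fin !sum_sx mulr1 mulrN1.
rewrite cardsU1 iJ add1n exprS; move: (_ ^+ _) (sign_mean _ _ _) (sign_mean _ _ _).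
by move=> k m1 m2; rewrite le_eqVlt; apply/orP; left; apply/eqP; field.
Qed.

End SignEvents.

(** * Coefficient lists of any length, and the conclusion *)

Lemma hit_le_sorted {R : realType} (c : R) (l : seq R) : 0 < c -> c ^+ 2 = 2 / 3 ->
  sorted >=%R l -> (forall a, a \in l -> 0 <= a) -> \sum_(a <- l) a ^+ 2 = 1 ->
  sign_mean l (fun y => (`|y| < c)%R%:R) 0 <= 3 / 4.
Proof.
(* Eight appended zeros change nothing and provide the eight leading coefficients for [hit_le]. *)
move=> c0 c2 sl l0 l1; rewrite -(sign_mean_zeros _ _ _ 8).
have {}sl : sorted >=%R (l ++ nseq 8 0).
  move: sl l0; case: l {l1} => [_ _|a l]; first by rewrite /= !lexx.
  rewrite /= cat_path => -> l0 /=.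
  by rewrite !lexx !andbT l0// mem_last.
have {}l0 a : a \in l ++ nseq 8 0 -> 0 <= a.
  by rewrite mem_cat => /orP[/l0//|]; rewrite mem_nseq => /eqP->.
have {}l1 : \sum_(a <- l ++ nseq 8 0) a ^+ 2 = 1.
  by rewrite big_cat/= l1 !big_cons big_nil !expr0n/= !addr0.
have : (8 <= size (l ++ nseq 8 0%R))%N by rewrite size_cat size_nseq leq_addl.
move: (l ++ nseq 8 0) sl l0 l1 => {}l.
case: l => [|a1 [|a2 [|a3 [|a4 [|a5 [|a6 [|a7 [|a8 l]]]]]]]] // sl l0 l1 _.
move: sl => /= /andP[h1 /andP[h2 /andP[h3 /andP[h4 /andP[h5 /andP[h6 /andP[h7 h8]]]]]]].
apply: hit_le => // [|a al]; first by rewrite l0// !inE eqxx !orbT.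
split; first by rewrite l0// !inE al !orbT.
move: h8; rewrite path_sortedE; last by move=> x y z /= xy yz; apply: le_trans yz xy.
by move=> /andP[/allP/(_ _ al)].
Qed.

Theorem theorem5p4 (d : measure_display) (T : measurableType d)
    (R : realType) (P : probability T R) (n : nat)
    (a : 'I_n -> R) (eps : 'I_n -> {RV P >-> R})
    (ha : rademacher_coefficients a)
    (heps : forall i : 'I_n, random_sign (eps i))
    (hind : mutually_independent eps) :
  ((4^-1)%:E <=
    P [set t | (2 / Num.sqrt 6 <= `|rademacher_sum a eps t|)%R])%E.
Proof.
case: ha => a_le a_gt0 a_sum; set c := 2 / Num.sqrt 6.
have c0 : 0 < c by rewrite divr_gt0 ?sqrtr_gt0.
have c2 : c ^+ 2 = 2 / 3 by rewrite expr_div_n sqr_sqrtr ?ler0n//; field.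
set E := [set t | _].
have mE : measurable E.
  have mX : measurable_fun setT (rademacher_sum a eps).
    by apply: measurable_sum => i; apply: measurable_funM.
  have mN : measurable_fun setT (fun t => `|rademacher_sum a eps t|).
    exact: measurableT_comp.
  rewrite (_ : E = setT `&` (fun t => `|rademacher_sum a eps t|) @^-1` `[c, +oo[%classic).
    exact: mN.
  by rewrite setTI; apply/seteqP; split=> t /=; rewrite in_itv/= andbT.
(* The induction starts with every sign free. *)
have J0 : finset.set0 = [set i : 'I_n | i \notin enum 'I_n]%SET.
  by apply/setP => i; rewrite !inE mem_enum.
have := sign_mean_le_prob heps hind mE (fun t => id) (fun=> or_introl erefl)
  (enum_uniq _) J0.
rewrite cards0 expr0 mul1r big_set0 => h.
apply: le_trans (le_trans h _); last first.
  by apply: le_measure; rewrite ?inE//; apply: measurableI => //; exact: measurable_sign_event.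
set l := map a _; rewrite lee_fin.
have : sign_mean l (fun y => (`|y| < c)%R%:R) 0 <= 3 / 4.
  apply: hit_le_sorted => //.
  - rewrite sorted_map; apply: (@sub_sorted _ (relpre val leq)).
      by move=> i j /=; apply: a_le.
    by have := iota_sorted 0 n; rewrite -val_enum_ord sorted_map.
  - by move=> _ /mapP[i _ ->]; apply: ltW.
  - by rewrite big_map -a_sum big_enum.
(* Complementary indicators turn the upper bound 3/4 into the lower bound 1/4. *)
have : sign_mean l (fun y => (c <= `|y|)%R%:R + (`|y| < c)%R%:R) 0 = 1.
  rewrite -[RHS](sign_mean_cst l 1 0); apply: eq_sign_mean => y.
  by case: leP; rewrite ?addr0 ?add0r.
rewrite sign_meanD; lra.
Qed.
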